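(* Fix $\sigma>0$. For each $\beta>0$ let $(\lambda,m)=(\lambda_\beta,m_\beta)$ be a real solution, with $\lambda>0$, of $$\lambda=\frac{1}{\sigma^2+\beta(1-m)},\qquad m=\int_{\mathbb R}\tanh\big(\sqrt\lambda\,z+\lambda\big)\,D_z,$$ and let $$C_{\mathrm T}(\beta)=\frac1{2\beta}\log_2\left(1+\frac{\beta(1-m)}{\sigma^2}\right)+g(\lambda,m)\log_2 e,\qquad g(\lambda,m)=\frac\lambda2(1+m)-\int_{\mathbb R}\ln\cosh\big(\sqrt\lambda\,z+\lambda\big)\,D_z .$$ Then $$\lim_{\beta\to\infty}\frac{C_{\mathrm T}(\beta)}{\frac1{2\beta}\log_2\left(1+\frac{\beta}{\sigma^2}\right)}=1 .$$
   Context: $D_z=\frac{1}{\sqrt{2\pi}}e^{-z^2/2}\,dz$ is the standard normal measure. The quantity $C_{\mathrm T}(\beta)$ is Tanaka's formula for the large-system normalized sum capacity of binary CDMA with noise variance $\sigma^2$ and user-to-spreading-gain ratio $\beta$. Here $m$ denotes a real parameter. *)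

(* Defs.v *)
From HB Require Import structures.
From mathcomp Require Import all_boot all_order all_algebra.
From mathcomp Require Import all_classical all_reals all_analysis.

Set Implicit Arguments.
Unset Strict Implicit.
Unset Printing Implicit Defensive.

Import Order.TTheory GRing.Theory Num.Theory.
Import numFieldNormedType.Exports.

Local Open Scope classical_set_scope.
Local Open Scope ring_scope.

Definition sinh (R : realType) (x : R) : R := (expR x - expR (- x)) / 2.

Definition cosh (R : realType) (x : R) : R := (expR x + expR (- x)) / 2.

Definition tanh (R : realType) (x : R) : R := sinh x / cosh x.

Definition log2 (R : realType) (x : R) : R := ln x / ln 2.

(* Real-valued Lebesgue integral against D_z, i.e. [normal_prob] with mean 0
   and standard deviation 1. As with any [Rintegral], it is only meaningful for
   integrable f; the two integrands used below are bounded or have at most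
   linear growth. *)
Definition std_normal_integral (R : realType) (f : R -> R) : R :=
  \int[normal_prob (0 : R) 1]_z f z.

Definition tanaka_solution (R : realType) (sigma beta lambda m : R) : Prop :=
  [/\ 0 < lambda,
      lambda = 1 / (sigma ^+ 2 + beta * (1 - m)) &
      m = std_normal_integral (fun z => tanh (Num.sqrt lambda * z + lambda))].

Definition tanaka_g (R : realType) (lambda m : R) : R :=
  lambda / 2 * (1 + m)
  - std_normal_integral (fun z => ln (cosh (Num.sqrt lambda * z + lambda))).

Definition tanaka_capacity (R : realType) (sigma beta lambda m : R) : R :=
  1 / (2 * beta) * log2 (1 + beta * (1 - m) / sigma ^+ 2)
  + tanaka_g lambda m * log2 (expR 1).

(* Main.v *)
(* As [|m| <= 1], [lambda] stays in [(0, sigma^-2]]; on this range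
   [int tanh (sqrt lambda * z + lambda) D_z] is bounded away from 1, so
   [1 - m >= c > 0] and [lambda <= 1 / (c * beta)]. Since
   [0 <= ln (cosh y) <= 2 * y ^+ 2], also [g (lambda, m) = O(lambda)], hence
   [beta * g] is bounded. Up to the factor [1 / (2 * beta * ln 2)], the capacity
   is therefore [ln (1 + beta / sigma ^+ 2)] plus a bounded term. *)
Require Import Defs.
From HB Require Import structures.
From mathcomp Require Import all_boot all_order all_algebra.
From mathcomp Require Import all_classical all_reals all_analysis.
From mathcomp Require Import measurable_realfun.
From mathcomp Require Import ring lra.

Import Order.TTheory GRing.Theory Num.Theory.
Import numFieldNormedType.Exports.

Local Open Scope classical_set_scope.
Local Open Scope ring_scope.

(** * Hyperbolic functions: elementary bounds and continuity *)

Lemma cosh_gt0 {R : realType} (x : R) : 0 < cosh x.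
Proof. by rewrite /cosh divr_gt0 ?addr_gt0 ?expR_gt0. Qed.

Lemma cosh_ge1 {R : realType} (x : R) : 1 <= cosh x.
Proof.
rewrite /cosh; have := expR_ge1Dx x; have := expR_ge1Dx (- x); lra.
Qed.

Lemma normr_tanh_le1 {R : realType} (x : R) : `|tanh x| <= 1.
Proof.
rewrite /tanh normrM normfV (gtr0_norm (cosh_gt0 x)).
rewrite ler_pdivrMr ?cosh_gt0// mul1r ler_norml /sinh /cosh.
by have := expR_gt0 x; have := expR_gt0 (- x); lra.
Qed.

(** Reduces monotonicity of [tanh] and the strict bound by 1 to facts about [expR], without
    derivatives. *)
Lemma one_sub_tanh {R : realType} (x : R) :
  1 - tanh x = 2 / (1 + expR (2 * x)).
Proof.
rewrite /tanh /sinh /cosh expRN (_ : 2 * x = x + x) ?expRD; last ring.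
have := expR_gt0 x; move: (expR x) => e e0.
by field; rewrite !gt_eqF//; nra.
Qed.

Lemma tanh_le {R : realType} (x y : R) : x <= y -> tanh x <= tanh y.
Proof.
move=> xy; suff: 1 - tanh y <= 1 - tanh x by lra.
rewrite !one_sub_tanh ler_pM2l// lef_pV2 ?posrE ?addr_gt0 ?expR_gt0//.
by rewrite lerD2l ler_expR ler_pM2l.
Qed.

Lemma tanh_lt1 {R : realType} (x : R) : tanh x < 1.
Proof.
by rewrite -subr_gt0 one_sub_tanh divr_gt0 ?addr_gt0 ?expR_gt0.
Qed.

Lemma ln_cosh_le_normr {R : realType} (x : R) : ln (cosh x) <= `|x|.
Proof.
rewrite -ler_expR lnK ?posrE ?cosh_gt0//.
rewrite /cosh ler_pdivrMr// mulr_natr mulr2n lerD// ler_expR ?ler_norm//.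
by rewrite -normrN ler_norm.
Qed.

(** Away from 0 the linear bound suffices; near 0 a bound on [cosh] is combined with
    [ln (1 + t) <= t]. Quadratic order matters: at an argument of scale [sqrt lambda] it gives a
    term of order [lambda], where the linear bound gives only [sqrt lambda]. *)
Lemma ln_cosh_le_sqr {R : realType} (x : R) : ln (cosh x) <= 2 * x ^+ 2.
Proof.
have [x2|x2] := leP (1 / 2) `|x|.
  apply: (le_trans (ln_cosh_le_normr x)).
  by rewrite -[x ^+ 2]ger0_norm ?sqr_ge0// normrX; nra.
have xx : x ^+ 2 < 1 / 4.
  rewrite -[x ^+ 2]ger0_norm ?sqr_ge0// normrX.
  by have := normr_ge0 x; nra.
move: x2; rewrite ltr_norml => /andP[x1 x2].
have expR_le (y : R) : y < 1 -> expR y <= (1 - y)^-1.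
  move=> y1; rewrite -[expR y]invrK -expRN lef_pV2 ?posrE ?expR_gt0//; last lra.
  by have := expR_ge1Dx (- y); lra.
(* Averaging [expR_le] at [x] and [- x] bounds [cosh x] by [1 / (1 - x ^+ 2)], and
   [(1 + 2 * w) * (1 - w) >= 1] for [0 <= w <= 1 / 2]. *)
have cosh_le : cosh x <= 1 + 2 * x ^+ 2.
  have h1 := expR_le x ltac:(lra); have h2 := expR_le (- x) ltac:(lra).
  apply: (@le_trans _ _ ((1 - x)^-1 / 2 + (1 - - x)^-1 / 2)).
    by rewrite /cosh; lra.
  rewrite (_ : _ + _ = (1 - x ^+ 2)^-1); last first.
    by field; rewrite !gt_eqF//; nra.
  by rewrite -[_^-1]mul1r ler_pdivrMr; nra.
apply: (@le_trans _ _ (ln (1 + 2 * x ^+ 2))).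
  by rewrite ler_ln ?posrE ?cosh_gt0//; have := sqr_ge0 x; lra.
by apply: le_ln1Dx; have := sqr_ge0 x; lra.
Qed.

Lemma continuous_cosh {R : realType} : continuous (@cosh R).
Proof.
move=> x; apply: cvgM; last exact: cvg_cst.
apply: cvgD; first exact: continuous_expR.
apply: (@cvg_comp _ _ _ -%R expR); last exact: continuous_expR.
by apply: cvgN; exact: cvg_id.
Qed.

Lemma continuous_sinh {R : realType} : continuous (@sinh R).
Proof.
move=> x; apply: cvgM; last exact: cvg_cst.
apply: cvgB; first exact: continuous_expR.
apply: (@cvg_comp _ _ _ -%R expR); last exact: continuous_expR.
by apply: cvgN; exact: cvg_id.
Qed.

Lemma continuous_tanh {R : realType} : continuous (@tanh R).
Proof.
move=> x; apply: cvgM; first exact: continuous_sinh.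
by apply: cvgV; [rewrite gt_eqF ?cosh_gt0 | exact: continuous_cosh].
Qed.

(** * Integration against normal measures and quadratic envelopes *)

Lemma integral_normal_prob_ge0 {R : realType} (m s : R) (f : R -> \bar R) :
  measurable_fun [set: R] f -> (forall x, 0 <= f x)%E ->
  (\int[normal_prob m s]_x f x =
   \int[lebesgue_measure]_x (f x * (normal_pdf m s x)%:E))%E.
Proof.
move=> mf f0; have dom := normal_prob_dominates m s.
rewrite -(Radon_Nikodym_SigmaFinite.change_of_variables dom)//=.
have mpdf : measurable_fun setT (EFin \o normal_pdf m s).
  by apply/measurable_EFinP; exact: measurable_normal_pdf.
have intRN := Radon_Nikodym_SigmaFinite.f_integrable dom.
apply: ae_eq_integral => //=.
- by apply: emeasurable_funM => //; exact: measurable_int intRN.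
- exact: emeasurable_funM.
(* The Radon-Nikodym derivative agrees almost everywhere with [normal_pdf]: over each measurable set
   both integrate to its normal measure. *)
- apply: ae_eqe_mul2l; apply: integral_ae_eq => // E _ mE.
  by rewrite -Radon_Nikodym_SigmaFinite.f_integral.
Qed.

(* Comparison with the normal density of standard deviation 2. *)
Lemma integrable_sqr_normal_prob {R : realType} :
  (normal_prob (0 : R) 1).-integrable setT (EFin \o (fun z : R => z ^+ 2)).
Proof.
have mf : measurable_fun [set: R] (fun z : R => z ^+ 2).
  exact: measurable_funX.
have mfE : measurable_fun [set: R] (EFin \o (fun z : R => z ^+ 2)).
  exact/measurable_EFinP.
have p2 : 0 < normal_peak (2 : R) by rewrite normal_peak_gt0.
(* The exponents of the two densities differ by [3 / 8 * x ^+ 2], and [t <= expR t] at this value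
   gives [x ^+ 2 <= 8 / 3 * expR (3 / 8 * x ^+ 2)]; the peak ratio adjusts the normalization. *)
pose C : R := 8 / 3 * (normal_peak 1 / normal_peak 2).
have C0 : 0 <= C by rewrite mulr_ge0 ?divr_ge0 ?normal_peak_ge0.
apply/integrableP; split => //.
under eq_integral do rewrite /= ger0_norm ?sqr_ge0//.
rewrite integral_normal_prob_ge0//; last by move=> x; rewrite lee_fin sqr_ge0.
apply: (@le_lt_trans _ _
  (\int[lebesgue_measure]_x (C%:E * (normal_pdf 0 2 x)%:E))%E); last first.
  rewrite integralZl//; last exact: integrable_normal_pdf.
  by rewrite integral_normal_pdf mule1 ltry.
apply: ge0_le_integral => //=.
- by move=> x _; rewrite -EFinM lee_fin mulr_ge0 ?sqr_ge0 ?normal_pdf_ge0.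
- apply: emeasurable_funM => //.
  by apply/measurable_EFinP; exact: measurable_normal_pdf.
- apply: emeasurable_funM => //.
  by apply/measurable_EFinP; exact: measurable_normal_pdf.
move=> x _; rewrite -!EFinM lee_fin !normal_pdfE ?pnatr_eq0 ?oner_eq0//.
rewrite (_ : C * _ = normal_peak 1 * (8 / 3 * normal_fun 0 2 x)); last first.
  by rewrite /C; field; rewrite gt_eqF.
rewrite mulrCA ler_wpM2l ?normal_peak_ge0// /normal_fun subr0.
rewrite (_ : - x ^+ 2 / (1 ^+ 2 *+ 2) =
  - (3 / 8 * x ^+ 2) + - x ^+ 2 / (2 ^+ 2 *+ 2)); last by field.
rewrite expRD mulrA ler_wpM2r ?expR_ge0//.
rewrite expRN ler_pdivrMr ?expR_gt0//.
by have := expR_ge1Dx (3 / 8 * x ^+ 2); lra.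
Qed.

Lemma integrable_std_normal_quadratic {R : realType} (p q : R) :
  (normal_prob (0 : R) 1).-integrable setT
    (EFin \o (fun z : R => p * z ^+ 2 + q)).
Proof.
apply: (@integrableD _ _ _ (normal_prob (0 : R) 1) setT measurableT
  (fun z => p%:E * (z ^+ 2)%:E)%E (EFin \o cst q)).
- exact: integrableZl integrable_sqr_normal_prob.
- exact: finite_measure_integrable_cst.
Qed.

Lemma std_normal_integral_quadratic {R : realType} (p q : R) :
  std_normal_integral (fun z => p * z ^+ 2 + q) =
  p * std_normal_integral (fun z : R => z ^+ 2) + q.
Proof.
rewrite /std_normal_integral RintegralD//; first last.
- exact: finite_measure_integrable_cst.
- exact: integrableZl integrable_sqr_normal_prob.
rewrite RintegralZl//; last exact: integrable_sqr_normal_prob.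
by rewrite Rintegral_cst// [X in fine X]probability_setT mulr1.
Qed.

(** The two quadratics serve twice: with absolute values on their coefficients they dominate [f],
    which makes it integrable, and then monotonicity of the integral applies. All later integral
    estimates go through this lemma. *)
Lemma std_normal_integral_bounds {R : realType} (f : R -> R) (p q p' q' : R) :
  continuous f ->
  (forall z, p * z ^+ 2 + q <= f z <= p' * z ^+ 2 + q') ->
  p * std_normal_integral (fun z : R => z ^+ 2) + q <= std_normal_integral f <=
  p' * std_normal_integral (fun z : R => z ^+ 2) + q'.
Proof.
move=> /continuous_measurable_fun mf fpq.
have intf : (normal_prob (0 : R) 1).-integrable setT (EFin \o f).
  apply: le_integrable
    (integrable_std_normal_quadratic (`|p| + `|p'|) (`|q| + `|q'|)) => //.
    exact/measurable_EFinP.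
  move=> z _ /=; rewrite lee_fin [leRHS]ger0_norm; last first.
    by apply: addr_ge0; [apply: mulr_ge0; [|exact: sqr_ge0]|]; exact: addr_ge0.
  have /andP[] := fpq z; have := sqr_ge0 z; move: (z ^+ 2) => w w0 lo hi.
  have := ler_norm p'; have := ler_norm q'; have := ler_norm (- p).
  have := ler_norm (- q); rewrite !normrN => *.
  have := normr_ge0 p; have := normr_ge0 q; have := normr_ge0 p'.
  have := normr_ge0 q' => *.
  by rewrite ler_norml; apply/andP; split; nra.
rewrite -!std_normal_integral_quadratic /std_normal_integral.
by apply/andP; split; apply: le_Rintegral => //;
  try exact: integrable_std_normal_quadratic;
  move=> z _; have /andP[] := fpq z.
Qed.

(** * Gaussian averages of [tanh] and [ln cosh] at an affine argument *)

Lemma continuous_affine {R : realType} (a b : R) :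
  continuous (fun z => a * z + b).
Proof.
by move=> z; apply: cvgD; [apply: cvgM; [exact: cvg_cst|]|exact: cvg_cst].
Qed.

(** Removes the cross term, so that the bound has the shape required by
    [std_normal_integral_bounds]. *)
Lemma sqr_affine_le {R : realType} (a b z : R) :
  (a * z + b) ^+ 2 <= 2 * a ^+ 2 * z ^+ 2 + 2 * b ^+ 2.
Proof. by have := sqr_ge0 (a * z - b); nra. Qed.

Lemma continuous_tanh_affine {R : realType} (a b : R) :
  continuous (fun z => tanh (a * z + b)).
Proof.
move=> z; apply: (@continuous_comp R R R (fun z => a * z + b) (@tanh R)).
  exact: continuous_affine.
exact: continuous_tanh.
Qed.

Lemma std_normal_integral_tanh_bounds {R : realType} (a b : R) :
  -1 <= std_normal_integral (fun z => tanh (a * z + b)) <= 1.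
Proof.
have := @std_normal_integral_bounds R _ 0 (- 1) 0 1
  (continuous_tanh_affine a b).
rewrite !mul0r !add0r; apply => z.
by rewrite !mul0r !add0r -ler_norml normr_tanh_le1.
Qed.

Lemma std_normal_integral_ln_cosh_bounds {R : realType} (a b : R) :
  0 <= std_normal_integral (fun z => ln (cosh (a * z + b))) <=
  4 * a ^+ 2 * std_normal_integral (fun z : R => z ^+ 2) + 4 * b ^+ 2.
Proof.
have cf : continuous (fun z => ln (cosh (a * z + b))).
  move=> z; apply: (@continuous_comp R R R (fun z => cosh (a * z + b)) (@ln R)).
    apply: (@continuous_comp R R R (fun z => a * z + b) (@cosh R)).
      exact: continuous_affine.
    exact: continuous_cosh.
  by apply: continuous_ln; rewrite cosh_gt0.
have := @std_normal_integral_bounds R _ 0 0 (4 * a ^+ 2) (4 * b ^+ 2) cf.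
rewrite !mul0r !add0r; apply => z.
rewrite !mul0r !add0r ln_ge0 ?cosh_ge1//=.
by have := ln_cosh_le_sqr (a * z + b); have := sqr_affine_le a b z; lra.
Qed.

(* For [y ^+ 2 < D] the left-hand side of
   [1 - tanh y >= (1 - tanh (sqrt D)) * (1 - y ^+ 2 / D)] exceeds the first
   factor, and otherwise the right-hand side is nonpositive; [D] is twice a
   bound on the second moment of the argument. *)
Lemma std_normal_integral_tanh_lt1 {R : realType} (L : R) : 0 < L ->
  exists c : R, [/\ 0 < c, c <= 1 &
    forall l, 0 < l -> l <= L ->
      std_normal_integral (fun z => tanh (Num.sqrt l * z + l)) <= 1 - c].
Proof.
move=> L0; pose K := std_normal_integral (fun z : R => z ^+ 2).
have K0 : 0 <= K by apply: Rintegral_ge0 => z _; exact: sqr_ge0.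
pose D := 4 * (L * K + L ^+ 2).
have D0 : 0 < D.
  have := exprn_gt0 2 L0; have := mulr_ge0 (ltW L0) K0.
  by rewrite /D; lra.
pose e := 1 - tanh (Num.sqrt D).
have e0 : 0 < e by rewrite subr_gt0 tanh_lt1.
(* The squared argument divided by [D] has mean at most 1/2, so half of [e] survives integration. *)
exists (e / 2); split; first by rewrite divr_gt0.
  have := normr_tanh_le1 (Num.sqrt D); rewrite ler_norml => /andP[].
  by rewrite /e; lra.
move=> l l0 lL.
have eD : 0 < e / D by rewrite divr_gt0.
have pointwise z : 0 * z ^+ 2 + - 1 <= tanh (Num.sqrt l * z + l) <=
    e / D * (2 * l) * z ^+ 2 + (1 - e + e / D * (2 * l ^+ 2)).
  set y := Num.sqrt l * z + l.
  have /andP[tanhN1 tanh1] : -1 <= tanh y <= 1.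
    by rewrite -ler_norml normr_tanh_le1.
  rewrite mul0r add0r tanhN1/=.
  apply: (@le_trans _ _ (1 - e + e / D * y ^+ 2)); last first.
    have := ler_wpM2l (ltW eD) (sqr_affine_le (Num.sqrt l) l z).
    by rewrite (sqr_sqrtr (ltW l0)) -/y; move: (e / D) (y ^+ 2) => t w; nra.
  have [yD|yD] := leP D (y ^+ 2).
    suff : e <= e / D * y ^+ 2 by lra.
    by rewrite mulrAC -mulrA ler_peMr ?(ltW e0)// ler_pdivlMr// mul1r.
  apply: (@le_trans _ _ (1 - e)).
    rewrite /e opprB addrC subrK tanh_le// (le_trans (ler_norm y))//.
    by rewrite -sqrtr_sqr ler_wsqrtr// ltW.
  by rewrite lerDl mulr_ge0 ?sqr_ge0// ltW.
have /andP[_ int_le] := @std_normal_integral_bounds R _ _ _ _ _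
  (continuous_tanh_affine (Num.sqrt l) l) pointwise.
apply: (le_trans int_le); rewrite -/K.
have lK : l * K <= L * K by rewrite ler_wpM2r.
have ll : l ^+ 2 <= L ^+ 2 by rewrite lerXn2r// ?nnegrE ltW.
have -> : e / D * (2 * l) * K + (1 - e + e / D * (2 * l ^+ 2)) =
  1 - e + e / D * (2 * (l * K + l ^+ 2)) by ring.
have : e / D * (2 * (l * K + l ^+ 2)) <= e / D * (D / 2).
  by rewrite ler_pM2l// /D; lra.
have -> : e / D * (D / 2) = e / 2 by field; rewrite gt_eqF.
by lra.
Qed.

(** * Tanaka's capacity and the limit *)

Lemma tanaka_ratioE {R : realType} (sigma b l m : R) : 0 < sigma -> 0 < b ->
  tanaka_capacity sigma b l m / (1 / (2 * b) * log2 (1 + b / sigma ^+ 2)) =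
  (ln (1 + b * (1 - m) / sigma ^+ 2) + 2 * b * tanaka_g l m) /
  ln (1 + b / sigma ^+ 2).
Proof.
(* As [log2 (expR 1)] becomes [1 / ln 2], the factor [1 / (2 * b * ln 2)] is common to numerator and
   denominator. *)
move=> s0 b0; rewrite /tanaka_capacity /log2 expRK.
have den0 : 0 < ln (1 + b / sigma ^+ 2).
  by rewrite ln_gt0// ltrDl divr_gt0// exprn_gt0.
have ln2_gt0 : 0 < ln 2 :> R by rewrite ln_gt0// ltr1n.
move: (ln (1 + b / _)) (ln (1 + b * _ / _)) (ln 2) den0 ln2_gt0.
by move=> x y z x0 z0; field; rewrite !gt_eqF.
Qed.

(** The constants depend on [sigma] alone, so the estimates are uniform in [b] and hold whichever
    solution is selected for each [b]. *)
Lemma tanaka_solution_bounds {R : realType} (sigma : R) : 0 < sigma ->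
  exists c B : R, [/\ 0 < c, c <= 1 &
    forall b l m, 0 < b -> tanaka_solution sigma b l m ->
      [/\ c <= 1 - m, 1 - m <= 2 & `|b * tanaka_g l m| <= B]].
Proof.
move=> s0; have v0 : 0 < sigma ^+ 2 by rewrite exprn_gt0.
have [c [c0 c1 tanh_c]] : exists c : R, [/\ 0 < c, c <= 1 &
    forall l, 0 < l -> l <= (sigma ^+ 2)^-1 ->
      std_normal_integral (fun z => tanh (Num.sqrt l * z + l)) <= 1 - c].
  by apply: std_normal_integral_tanh_lt1; rewrite invr_gt0.
pose K := std_normal_integral (fun z : R => z ^+ 2).
have K0 : 0 <= K by apply: Rintegral_ge0 => z _; exact: sqr_ge0.
pose L := (sigma ^+ 2)^-1.
(* In the bound on [tanaka_g] divided by [l], the 1 comes from [(1 + m) / 2] and [4 * K + 4 * L]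
   from the [ln cosh] integral with [l <= L]; the division by [c] comes from [b * l <= c^-1]. *)
exists c, ((1 + 4 * K + 4 * L) / c); split=> // b l m b0 [l0 lE mE].
have /andP[mN1 m1] := std_normal_integral_tanh_bounds (Num.sqrt l) l.
rewrite -mE in mN1 m1.
have bm0 : 0 <= b * (1 - m) by rewrite mulr_ge0 ?(ltW b0)// subr_ge0.
have lL : l <= L.
  rewrite lE div1r lef_pV2 ?posrE ?lerDl//.
  by rewrite ltr_wpDr.
have := tanh_c l l0 lL; rewrite -mE => mc.
(* Indeed [b * c <= b * (1 - m) <= 1 / l]. *)
have bl : b * l <= c^-1.
  rewrite -[c^-1]mul1r ler_pdivlMr// -mulrA mulrCA lE.
  rewrite div1r mulrC ler_pdivrMr ?ltr_wpDr// mul1r.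
  apply: (@le_trans _ _ (b * (1 - m))); first by rewrite ler_pM2l//; lra.
  by rewrite lerDr ltW.
split; [lra|lra|].
have /andP[E0 E1] := std_normal_integral_ln_cosh_bounds (Num.sqrt l) l.
have g_le : `|tanaka_g l m| <= l * (1 + 4 * K + 4 * L).
  move: E0 E1; rewrite /tanaka_g -/K (sqr_sqrtr (ltW l0)).
  move: (std_normal_integral _) => E E0 E1.
  have ll : l * l <= l * L by rewrite ler_pM2l.
  have lm : l * (1 + m) <= l * 2 by rewrite ler_pM2l//; lra.
  have lm0 : 0 <= l * (1 + m) by rewrite mulr_ge0 ?(ltW l0)//; lra.
  have lK := mulr_ge0 (ltW l0) K0.
  by rewrite ler_norml; apply/andP; split; nra.
rewrite normrM (gtr0_norm b0).
apply: (@le_trans _ _ (b * (l * (1 + 4 * K + 4 * L)))); first by rewrite ler_pM2l.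
rewrite mulrA mulrC [leRHS]mulrC [leRHS]mulrC ler_wpM2l//.
by rewrite !addr_ge0 ?mulr_ge0// ltW// invr_gt0.
Qed.

Theorem mainTheorem12 (R : realType) (sigma : R) (sigma_gt0 : 0 < sigma)
    (lambda m : R -> R)
    (solution : forall beta : R, 0 < beta ->
       tanaka_solution sigma beta (lambda beta) (m beta)) :
  tanaka_capacity sigma beta (lambda beta) (m beta)
    / (1 / (2 * beta) * log2 (1 + beta / sigma ^+ 2))
  @[beta --> +oo] --> (1 : R).
Proof.
have [c [B [c0 c1 bounds]]] := tanaka_solution_bounds _ sigma_gt0.
have v0 : 0 < sigma ^+ 2 by rewrite exprn_gt0.
(* [A] bounds the numerator of the error: the two logarithms differ by an amount between [ln c <= 0]
   and [ln 2 >= 0], and [2 * B] covers the term with [tanaka_g]. *)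
pose A := ln 2 - ln c + 2 * B.
apply/cvgrPdist_le => e e0; near=> b.
have b0 : 0 < b by near: b; exact: nbhs_pinfty_gt.
(* This threshold makes [ln (1 + b / sigma ^+ 2)] at least [A / e], hence the error at most [e]. *)
have bA : sigma ^+ 2 * expR (A / e) <= b.
  by near: b; apply: nbhs_pinfty_ge; rewrite num_real.
have [c_le le_2 gB] := bounds b (lambda b) (m b) b0 (solution b b0).
rewrite tanaka_ratioE//; set g := tanaka_g _ _ in gB *.
set x := 1 + b / sigma ^+ 2.
have x1 : 1 < x by rewrite ltrDl divr_gt0.
have x0 : 0 < x by rewrite (lt_trans _ x1).
have lnx0 : 0 < ln x by rewrite ln_gt0.
have lnx_ge : A / e <= ln x.
  rewrite -ler_expR lnK ?posrE//.
  move: bA; rewrite -ler_pdivlMl// [_^-1 * b]mulrC => /le_trans; apply.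
  by rewrite /x lerDr.
set y := 1 + b * (1 - m b) / sigma ^+ 2.
have bv0 : 0 < b / sigma ^+ 2 by rewrite divr_gt0.
have yE : y = 1 + b / sigma ^+ 2 * (1 - m b) by rewrite /y mulrAC.
(* The summand 1 is compared through [c <= 1], the other through [c <= 1 - m b]. *)
have cxy : c * x <= y by rewrite yE /x; nra.
have yx : y <= 2 * x by rewrite yE /x; nra.
have y0 : 0 < y by rewrite (lt_le_trans _ cxy)// mulr_gt0.
have ylo : ln c + ln x <= ln y.
  by rewrite -lnM ?posrE// ler_ln ?posrE// mulr_gt0.
have yhi : ln y <= ln 2 + ln x.
  by rewrite -lnM ?posrE// ler_ln ?posrE// mulr_gt0.
have lnc : ln c <= 0 by rewrite ln_le0.
have ln2 : 0 <= ln 2 :> R by rewrite ln_ge0// ler1n.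
rewrite (_ : 1 - _ = (ln x - ln y - 2 * (b * g)) / ln x); last first.
  by field; rewrite gt_eqF.
rewrite normrM normfV (gtr0_norm lnx0) ler_pdivrMr//.
apply: (@le_trans _ _ A); last by rewrite mulrC -ler_pdivrMr.
move: gB; rewrite !ler_norml => /andP[gB1 gB2].
by apply/andP; rewrite /A; split; lra.
Unshelve. all: by end_near. Qed.
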